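(* For all intensity functions $h$, if $\int_0^\infty h(y)\,dy=a<\infty$, then $$\lim_{x_e\to\infty}PoA(h,x_e)=1 .$$
   Context: Consider a single-server loss system (an arriving customer who finds the server busy balks) with general service distribution of average rate $\mu>0$ and the server located at the origin. An intensity function is any nonnegative function $h$ on $[0,\infty)$ for which $\lambda(x)=\int_0^x h(y)\,dy$ is finite for all $x\ge 0$; customers with distance less than $x$ from the server arrive as a Poisson process of rate $\lambda(x)$. The benefit from a completed service is $R$, the waiting cost per unit time in the system is $c_w$, the travel cost per unit distance is $c_t>0$ (travel is instantaneous), and $\frac{R\mu}{c_w}>1$. Under a threshold strategy $x$, a customer joins if and only if the server is idle and his distance is at most $x$. The Nash equilibrium threshold is $x_e=\frac{R\mu-c_w}{c_t\mu}$; it is treated as a positive parameter, with $\mu$ and $h$ fixed. The expected social benefit per unit time with threshold $x$ is $$S(x)=\frac{c_t\int_0^x (x_e-y)h(y)\,dy}{1+\frac1\mu\int_0^x h(y)\,dy}.$$ The socially optimal threshold $x^*$, which maximizes $S$, is given as the unique $x\ge 0$ satisfying $x_e=\frac1\mu\int_0^{x}(x-y)h(y)\,dy+x$; it depends on $x_e$, $h$ and $\mu$. The price of anarchy is $$PoA(h,x_e)=\frac{S(x^* )}{S(x_e)}=\frac{\int_{0}^{x^*} (x_e-y)h(y)\,dy}{\int_{0}^{x_e} (x_e-y)h(y)\,dy}\cdot\frac{1+\frac{1}{\mu} \int_{0}^{x_e} h(y)\,dy}{1+\frac{1}{\mu} \int_{0}^{x^*} h(y)\,dy}.$$ *)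

(* Defs.v *)
From mathcomp Require Import all_boot all_order all_algebra.
From mathcomp Require Import all_classical all_reals all_analysis.
Set Implicit Arguments.
Unset Strict Implicit.
Unset Printing Implicit Defensive.
Import Order.TTheory GRing.Theory Num.Theory.
Import numFieldNormedType.Exports.
Local Open Scope classical_set_scope.
Local Open Scope ring_scope.

(* [h] stands for a function on [0, +oo[: its values at negative points are
   unconstrained and never used.  Integrability on [0, x] is measurability
   together with finiteness of the integral of h >= 0. *)
Definition intensity_function (R : realType) (h : R -> R) : Prop :=
  (forall y, 0 <= y -> 0 <= h y) /\
  (forall x, 0 <= x -> lebesgue_measure.-integrable `[0, x] (EFin \o h)).

Definition arrival_rate (R : realType) (h : R -> R) (x : R) : R :=
  \int[lebesgue_measure]_(y in `[0, x]) h y.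

Definition social_benefit (R : realType) (ct mu : R) (h : R -> R) (xe x : R) : R :=
  ct * (\int[lebesgue_measure]_(y in `[0, x]) ((xe - y) * h y)) /
  (1 + mu^-1 * arrival_rate h x).

Definition is_optimal_threshold (R : realType) (mu : R) (h : R -> R) (xe x : R) : Prop :=
  0 <= x /\
  xe = mu^-1 * (\int[lebesgue_measure]_(y in `[0, x]) ((x - y) * h y)) + x.

(* The default value 0 of [xget] plays no role for mu, xe > 0 and an intensity
   function h: the right-hand side of the equation is then continuous, strictly
   increasing and unbounded in x >= 0, so exactly one threshold satisfies it. *)
Definition optimal_threshold (R : realType) (mu : R) (h : R -> R) (xe : R) : R :=
  xget 0 [set x | is_optimal_threshold mu h xe x].

(* If h = 0 almost everywhere then both social benefits are 0 and the ratio,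
   which is 0 here, has no meaning. *)
Definition PoA (R : realType) (ct mu : R) (h : R -> R) (xe : R) : R :=
  social_benefit ct mu h xe (optimal_threshold mu h xe) /
  social_benefit ct mu h xe xe.

(* In particular the price of anarchy does not depend on the travel cost. *)
Lemma PoAE (R : realType) (ct mu : R) (h : R -> R) (xe : R) : ct != 0 ->
  let xs := optimal_threshold mu h xe in
  PoA ct mu h xe =
  (\int[lebesgue_measure]_(y in `[0, xs]) ((xe - y) * h y)) /
  (\int[lebesgue_measure]_(y in `[0, xe]) ((xe - y) * h y)) *
  ((1 + mu^-1 * arrival_rate h xe) / (1 + mu^-1 * arrival_rate h xs)).
Proof.
move=> ct0 /=; rewrite /PoA /social_benefit.
have ratioE (A B C D : R) : ct * A / C / (ct * B / D) = A / B * (D / C).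
  rewrite -(mulrA ct A) -(mulrA ct B) invfM invf_div mulrACA mulfV// mul1r.
  by rewrite !mulf_div [C * B]mulrC.
exact: ratioE.
Qed.

(* Main.v *)
Require Import Defs.
From mathcomp Require Import all_boot all_order all_algebra.
From mathcomp Require Import all_classical all_reals all_analysis.
From mathcomp Require Import measurable_realfun ring lra.
Set Implicit Arguments.
Unset Strict Implicit.
Unset Printing Implicit Defensive.
Import Order.TTheory GRing.Theory Num.Theory.
Import numFieldNormedType.Exports.
Local Open Scope classical_set_scope.
Local Open Scope ring_scope.

(* Write N(x) for the integral of h over [0, x] and G(x) for the integral of
   (x - y) h(y) over [0, x].  At a solution s of xe = G(s) / mu + s one has
   xe - s = G(s) / mu, hence S(s) = ct G(s), and of course
   S(xe) = ct G(xe) / (1 + N(xe) / mu).  Moreover xe = s (1 + G(s) / (s mu)), so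

     PoA = (G(s) / s) (1 + N(xe) / mu) / ((G(xe) / xe) (1 + G(s) / (s mu))).

   Since N(x) tends to a, so does G(x) / x, and s tends to infinity with xe
   because G(s) <= a s; all the factors converge. *)

(** * Integrals of [h] and of its weighted versions over initial segments *)

Definition first_moment (R : realType) (h : R -> R) (x : R) : R :=
  \int[lebesgue_measure]_(y in `[0, x]) (y * h y).

Definition threshold_surplus (R : realType) (h : R -> R) (x : R) : R :=
  \int[lebesgue_measure]_(y in `[0, x]) ((x - y) * h y).

Lemma first_moment_integrable (R : realType) (h : R -> R) (x : R) :
  intensity_function h -> 0 <= x ->
  lebesgue_measure.-integrable `[0, x] (EFin \o (fun y => y * h y)).
Proof.
move=> [h0 hi] x0.
apply: le_integrable (integrableZl _ x (hi x x0)) => //.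
- apply/measurable_EFinP/measurable_funM => //.
  apply/measurable_EFinP; apply: (measurable_int _ (hi x x0)).
- move=> y /=; rewrite in_itv/= => /andP[y0 yx].
  rewrite lee_fin !ger0_norm ?mulr_ge0 ?h0//.
  by rewrite ler_wpM2r// h0.
Qed.

(** Linearity moves the parameter [c] out of the integrand and leaves integrals of two fixed
    functions. *)
Lemma weighted_integralE (R : realType) (h : R -> R) (c x : R) :
  intensity_function h -> 0 <= x ->
  \int[lebesgue_measure]_(y in `[0, x]) ((c - y) * h y) =
  c * arrival_rate h x - first_moment h x.
Proof.
move=> hh x0; have [_ hi] := hh.
rewrite -RintegralZl//; last exact: hi.
rewrite -RintegralB//; last 2 first.
- by apply: integrableZl (hi x x0).
- exact: first_moment_integrable.
by apply: eq_Rintegral => y _; rewrite mulrBl.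
Qed.

Lemma arrival_rate_increment (R : realType) (h : R -> R) (x z : R) :
  intensity_function h -> 0 <= x -> x <= z ->
  arrival_rate h z - arrival_rate h x =
  \int[lebesgue_measure]_(y in `]x, z]) h y.
Proof.
move=> [h0 hi] x0 xz.
by rewrite Rintegral_itvB ?bnd_simp//; exact/hi/(le_trans x0).
Qed.

Lemma arrival_rate_ge0 (R : realType) (h : R -> R) (x : R) :
  intensity_function h -> 0 <= arrival_rate h x.
Proof.
move=> [h0 _]; apply: Rintegral_ge0 => y /=.
by rewrite in_itv/= => /andP[/h0].
Qed.

Lemma le_arrival_rate (R : realType) (h : R -> R) (x z : R) :
  intensity_function h -> 0 <= x -> x <= z ->
  arrival_rate h x <= arrival_rate h z.
Proof.
move=> hh x0 xz; rewrite -subr_ge0 arrival_rate_increment//.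
apply: Rintegral_ge0 => y /=; rewrite in_itv/= => /andP[xy _].
by apply hh; exact/ltW/(le_lt_trans x0).
Qed.

(** On []x, z]] the weight [y] of [h y] lies between [x] and [z]. *)
Lemma first_moment_increment (R : realType) (h : R -> R) (x z : R) :
  intensity_function h -> 0 <= x -> x <= z ->
  x * (arrival_rate h z - arrival_rate h x)
    <= first_moment h z - first_moment h x
    <= z * (arrival_rate h z - arrival_rate h x).
Proof.
move=> hh x0 xz; have z0 := le_trans x0 xz.
have im := first_moment_integrable hh z0.
have [h0 hi] := hh.
have sub : `]x, z] `<=` `[0, z].
  by apply: subset_itvr; rewrite bnd_simp.
have int_sub f : lebesgue_measure.-integrable `[0, z] (EFin \o f) ->
    lebesgue_measure.-integrable `]x, z] (EFin \o f).
  by apply: integrableS => //; exact: measurable_itv.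
have hi' := int_sub _ (hi z z0).
have im' := int_sub _ im.
rewrite arrival_rate_increment// Rintegral_itvB ?bnd_simp//.
rewrite -!RintegralZl//.
by apply/andP; split; apply: le_Rintegral => //;
  try exact: (integrableZl _ _ hi');
  move=> y /=; rewrite in_itv/= => /andP[xy yz];
  rewrite ler_wpM2r ?h0 ?(ltW xy)// (le_trans x0 (ltW xy)).
Qed.

Lemma threshold_surplusE (R : realType) (h : R -> R) (x : R) :
  intensity_function h -> 0 <= x ->
  threshold_surplus h x = x * arrival_rate h x - first_moment h x.
Proof. exact: weighted_integralE. Qed.

(** G is a primitive of the nondecreasing function N, which suggests these bounds. They follow from
    G(x) = x N(x) - M(x), with M the first moment, and the bounds on the increment of M. *)
Lemma threshold_surplus_increment (R : realType) (h : R -> R) (x z : R) :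
  intensity_function h -> 0 <= x -> x <= z ->
  (z - x) * arrival_rate h x <= threshold_surplus h z - threshold_surplus h x
    <= (z - x) * arrival_rate h z.
Proof.
move=> hh x0 xz; rewrite !threshold_surplusE ?(le_trans x0 xz)//.
have /andP[lo hi] := first_moment_increment hh x0 xz.
by apply/andP; split; lra.
Qed.

Lemma threshold_surplus0 (R : realType) (h : R -> R) :
  threshold_surplus h 0 = 0.
Proof. by rewrite /threshold_surplus set_itv1 Rintegral_set1. Qed.

Lemma threshold_surplus_ge0 (R : realType) (h : R -> R) (x : R) :
  intensity_function h -> 0 <= threshold_surplus h x.
Proof.
move=> [h0 _]; apply: Rintegral_ge0 => y /=.
by rewrite in_itv/= => /andP[/h0 hy yx]; rewrite mulr_ge0// subr_ge0.
Qed.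

(** * Continuity of the surplus and existence of the optimal threshold *)

Lemma threshold_surplus_continuous (R : realType) (h : R -> R) (z : R) :
  intensity_function h -> 0 <= z ->
  {within `[0, z], continuous (threshold_surplus h)}.
Proof.
move=> hh z0.
have cN := parameterized_integral_continuous z0 (hh.2 z z0).
have cM :=
  parameterized_integral_continuous z0 (first_moment_integrable hh z0).
have cf : {within `[0, z],
    continuous (fun x => x * arrival_rate h x - first_moment h x)}.
  move=> x; apply: cvgB; last exact: cM.
  apply: cvgM; last exact: cN.
  by apply: continuous_subspaceT => ?; exact: cvg_id.
apply: subspace_eq_continuous cf => x; rewrite inE/= in_itv/= => /andP[x0 _].
by rewrite /from_subspace/= threshold_surplusE.
Qed.

(** The intermediate value theorem on [[0, xe]] gives a solution, since f(x) = G(x) / mu + x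
    satisfies f(0) = 0 <= xe <= f(xe); hence [xget] returns a solution. *)
Lemma optimal_thresholdP (R : realType) (mu : R) (h : R -> R) (xe : R) :
  0 < mu -> intensity_function h -> 0 <= xe ->
  is_optimal_threshold mu h xe (optimal_threshold mu h xe).
Proof.
move=> mu0 hh xe0; apply: (xgetPex 0).
pose f x := mu^-1 * threshold_surplus h x + x.
have fc : {within `[0, xe], continuous f}.
  move=> x; apply: cvgD.
    by apply: cvgM; [exact: cvg_cst|exact: threshold_surplus_continuous].
  by apply: continuous_subspaceT => ?; exact: cvg_id.
have f0 : f 0 = 0 by rewrite /f threshold_surplus0 mulr0 addr0.
have fxe : xe <= f xe.
  by rewrite lerDr mulr_ge0 ?invr_ge0 ?(ltW mu0)// threshold_surplus_ge0.
have [|s] := IVT (v := xe) xe0 fc.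
  by rewrite f0 ge_min xe0/= le_max fxe orbT.
by rewrite in_itv/= => /andP[s0 _] fs; exists s; split.
Qed.

(** * Limits at infinity for total mass [a] *)

Lemma arrival_rate_cvgn (R : realType) (h : R -> R) (a : R) :
  intensity_function h ->
  (\int[lebesgue_measure]_(y in `[0%R, +oo[) (h y)%:E = a%:E)%E ->
  arrival_rate h n.+1%:R @[n --> \oo] --> a.
Proof.
move=> [h0 hi] ha.
apply: (@fine_cvg _ _ _ _
  (fun n => \int[lebesgue_measure]_(y in `[0%R, n.+1%:R]) (h y)%:E)%E).
(* Monotone convergence along the segments [[0, n.+1]], whose union is the half-line. *)
rewrite -ha itv0y_bigcup0S.
apply: ge0_nondecreasing_set_cvg_integral.
- move=> m n mn; rewrite subsetEset; apply: subset_itvl.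
  by rewrite bnd_simp ler_nat.
- by move=> n; exact: measurable_itv.
- by move=> n; exact: measurable_int (hi _ (ler0n _ _)).
- by move=> n x /=; rewrite in_itv/= lee_fin => /andP[/h0].
Qed.

Lemma arrival_rate_le_total (R : realType) (h : R -> R) (a x : R) :
  intensity_function h ->
  (\int[lebesgue_measure]_(y in `[0%R, +oo[) (h y)%:E = a%:E)%E ->
  0 <= x -> arrival_rate h x <= a.
Proof.
move=> hh ha x0.
have ca := arrival_rate_cvgn hh ha.
rewrite -(cvg_lim _ ca)//; apply: limr_ge; first by apply/cvg_ex; exists a.
near=> n; apply: le_arrival_rate => //.
apply: (@le_trans _ _ n%:R); last by rewrite ler_nat.
by near: n; exact: nbhs_infty_ger.
Unshelve. all: by end_near. Qed.

(** Monotonicity and the upper bound [a] carry the convergence from integers over to real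
    arguments. *)
Lemma arrival_rate_cvg (R : realType) (h : R -> R) (a : R) :
  intensity_function h ->
  (\int[lebesgue_measure]_(y in `[0%R, +oo[) (h y)%:E = a%:E)%E ->
  arrival_rate h x @[x --> +oo] --> a.
Proof.
move=> hh ha; apply/cvgrPdist_le => e e0.
have /cvgrPdist_le/(_ e e0)[n _ /(_ n (leqnn _))/= hn] :=
  arrival_rate_cvgn hh ha.
near=> x; have nx : n.+1%:R <= x by near: x; exact: nbhs_pinfty_ge (num_real _).
have n0 : 0 <= n.+1%:R :> R by [].
rewrite ger0_norm ?subr_ge0; last first.
  exact/arrival_rate_le_total/(le_trans n0).
apply: le_trans hn; rewrite (le_trans _ (ler_norm _))// lerB//.
exact: le_arrival_rate.
Unshelve. all: by end_near. Qed.

Lemma threshold_surplus_le (R : realType) (h : R -> R) (a x : R) :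
  intensity_function h ->
  (\int[lebesgue_measure]_(y in `[0%R, +oo[) (h y)%:E = a%:E)%E ->
  0 <= x -> threshold_surplus h x <= x * a.
Proof.
move=> hh ha x0.
have /andP[_] := threshold_surplus_increment hh (lexx 0) x0.
rewrite threshold_surplus0 !subr0 => /le_trans; apply.
by rewrite ler_wpM2l// arrival_rate_le_total.
Qed.

(** Above, G(x) / x <= a. Below, fix c with a - N(c) <= e / 2; for x >= c, G(x) >= (x - c) N(c) >= x
    N(c) - c a, so that a - G(x) / x <= e / 2 + c a / x. *)
Lemma threshold_surplus_avg_cvg (R : realType) (h : R -> R) (a : R) :
  intensity_function h ->
  (\int[lebesgue_measure]_(y in `[0%R, +oo[) (h y)%:E = a%:E)%E ->
  threshold_surplus h x / x @[x --> +oo] --> a.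
Proof.
move=> hh ha; apply/cvgrPdist_le => e e0.
have e20 : 0 < e / 2 by rewrite divr_gt0.
have : \forall c \near +oo, `|a - arrival_rate h c| <= e / 2 /\ 0 < c.
  near=> c; split; near: c; last exact: nbhs_pinfty_gt (num_real _).
  by move: (e / 2) e20; apply/cvgrPdist_le/arrival_rate_cvg.
move=> /filter_ex[c [hc c0]].
have ca : arrival_rate h c <= a by apply/arrival_rate_le_total/ltW.
rewrite ger0_norm ?subr_ge0// in hc.
near=> x.
have cx : c <= x by near: x; exact: nbhs_pinfty_ge (num_real _).
have x0 : 0 < x by apply: lt_le_trans cx.
(* From here on the error c a / x is at most e / 2. *)
have xb : 2 * c * a / e <= x by near: x; exact: nbhs_pinfty_ge (num_real _).
have up := threshold_surplus_le hh ha (ltW x0).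
have /andP[lo _] := threshold_surplus_increment hh (ltW c0) cx.
have G0 := threshold_surplus_ge0 c hh.
have {}xb : 2 * c * a <= x * e by rewrite -ler_pdivrMr.
have cN : c * arrival_rate h c <= c * a by rewrite ler_wpM2l// ltW.
have xN : x * (a - arrival_rate h c) <= x * (e / 2) by rewrite ler_wpM2l// ltW.
rewrite ger0_norm ?subr_ge0 ?ler_pdivrMr//; last by rewrite mulrC.
by rewrite lerBlDr -lerBlDl ler_pdivlMr//; lra.
Unshelve. all: by end_near. Qed.

Lemma optimal_threshold_cvgy (R : realType) (mu : R) (h : R -> R) (a : R) :
  0 < mu -> 0 < a -> intensity_function h ->
  (\int[lebesgue_measure]_(y in `[0%R, +oo[) (h y)%:E = a%:E)%E ->
  optimal_threshold mu h xe @[xe --> +oo] --> +oo.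
Proof.
move=> mu0 a0 hh ha; apply/cvgryPge => A.
near=> xe.
have xe0 : 0 <= xe by near: xe; exact: nbhs_pinfty_ge (num_real _).
(* The factor comes from xe = G(s) / mu + s <= s (1 + a / mu). *)
have xeA : A * (1 + mu^-1 * a) <= xe.
  by near: xe; exact: nbhs_pinfty_ge (num_real _).
have [s0 xeE] := optimal_thresholdP mu0 hh xe0.
set s := optimal_threshold _ _ _ in s0 xeE *.
have := threshold_surplus_le hh ha s0.
rewrite -(@ler_pM2l _ mu^-1) ?invr_gt0// -(lerD2r s) -xeE.
move=> /(le_trans xeA).
rewrite (_ : _ + s = s * (1 + mu^-1 * a)); last by ring.
suff D0 : 0 < 1 + mu^-1 * a by rewrite ler_pM2r.
by rewrite ltr_wpDr// mulr_ge0 ?invr_ge0 ?ltW.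
Unshelve. all: by end_near. Qed.

(** * The price of anarchy through the averages G(x) / x *)

Lemma PoA_avgE (R : realType) (ct mu : R) (h : R -> R) (xe : R) :
  0 < ct -> 0 < mu -> intensity_function h -> 0 < xe ->
  let s := optimal_threshold mu h xe in
  let g x := threshold_surplus h x / x in
  0 < s -> 0 < g xe ->
  PoA ct mu h xe =
  g s * (1 + mu^-1 * arrival_rate h xe) / (g xe * (1 + mu^-1 * g s)).
Proof.
move=> ct0 mu0 hh xe0 /=.
have [_ xeE] := optimal_thresholdP mu0 hh (ltW xe0).
rewrite /PoA /social_benefit.
move: (optimal_threshold _ _ _) xeE => s xeE s0 g0.
have {}xeE : xe = mu^-1 * threshold_surplus h s + s := xeE.
have N0 x : 0 < 1 + mu^-1 * arrival_rate h x.
  by rewrite ltr_pwDl// mulr_ge0 ?invr_ge0 ?(ltW mu0)// arrival_rate_ge0.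
(* The integral is G(s) + (xe - s) N(s), and xe - s = G(s) / mu. The second factor cancels the
   denominator of S(s). *)
have SsE : \int[lebesgue_measure]_(y in `[0, s]) ((xe - y) * h y) =
    threshold_surplus h s * (1 + mu^-1 * arrival_rate h s).
  rewrite weighted_integralE ?(ltW s0)// {1}xeE.
  by rewrite (threshold_surplusE hh (ltW s0)); ring.
have xe_s : xe = s * (1 + mu^-1 * (threshold_surplus h s / s)).
  by rewrite {1}xeE; field; rewrite !gt_eqF.
have D0 : 1 + mu^-1 * (threshold_surplus h s / s) != 0.
  by apply: contraTneq xe0 => D0; rewrite xe_s D0 mulr0 ltxx.
have G0 : threshold_surplus h xe != 0.
  by apply: contraTneq g0 => ->; rewrite mul0r ltxx.
rewrite SsE -/(threshold_surplus h xe).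
move: (N0 s) (N0 xe) D0 => /lt0r_neq0 + /lt0r_neq0.
(* Only the divisor [xe] is replaced; the argument of G stays, so that G(xe) is an atom for
   [field]. *)
rewrite [threshold_surplus h xe / xe](_ : _ = threshold_surplus h xe /
  (s * (1 + mu^-1 * (threshold_surplus h s / s)))); last by rewrite -xe_s.
move: (1 + _ * arrival_rate h s) (1 + _ * arrival_rate h xe) (1 + _ * (_ / _)).
by move=> A B D A0 B0 D0; field; rewrite A0 B0 D0 G0 !gt_eqF.
Qed.

(** [h_total] is an equation in the extended reals and so carries the finiteness of the integral;
    [a_gt0] excludes the degenerate ratio 0 / 0. *)
Theorem theorem3p4 (R : realType) (ct mu : R) (ct_gt0 : 0 < ct) (mu_gt0 : 0 < mu)
    (h : R -> R) (h_intensity : intensity_function h)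
    (a : R) (a_gt0 : 0 < a)
    (h_total : (\int[lebesgue_measure]_(y in `[0%R, +oo[) (h y)%:E = a%:E)%E) :
  PoA ct mu h xe @[xe --> +oo] --> (1 : R).
Proof.
have cg := threshold_surplus_avg_cvg h_intensity h_total.
have cs := optimal_threshold_cvgy mu_gt0 a_gt0 h_intensity h_total.
have cN := arrival_rate_cvg h_intensity h_total.
have cgs := cvg_comp _ _ cs cg.
have D0 : 1 + mu^-1 * a != 0.
  by rewrite gt_eqF// ltr_wpDr// mulr_ge0 ?invr_ge0 ?ltW.
have one_D (f : R -> R) : f xe @[xe --> +oo] --> a ->
    1 + mu^-1 * f xe @[xe --> +oo] --> 1 + mu^-1 * a.
  by move=> cf; apply: cvgD; [exact: cvg_cst|apply: cvgM; [exact: cvg_cst|]].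
(* The limit is put in the form in which the limits of the factors, all expressed by [a], produce
   it. *)
rewrite (_ : 1 = a * (1 + mu^-1 * a) / (a * (1 + mu^-1 * a))); last first.
  by rewrite divff// mulf_neq0// gt_eqF.
have cD : a * (1 + mu^-1 * a) != 0 by rewrite mulf_neq0// gt_eqF.
have cPoA := cvgM (cvgM cgs (one_D _ cN)) (cvgV cD (cvgM cg (one_D _ cgs))).
apply: cvg_trans (cPoA _ _ _ _).
apply: near_eq_cvg; near=> xe.
(* The conditions [0 < s] and [0 < g xe] hold eventually, as s tends to infinity and g to [a]. *)
rewrite /= PoA_avgE//; near: xe.
- by move/cvgryPgt: cs; apply.
- exact: cvgr_gt cg _ a_gt0.
Unshelve. all: by end_near. Qed.
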